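(* Let $\mathcal{H}$ be a separable Hilbert space and let $\mathcal{W},\mathcal{V}$ be closed subspaces of $\mathcal{H}$ with $\mathcal{H}=\mathcal{W}\oplus\mathcal{V}^{\perp}$. Let $\mathcal{F}=\{f_k\}_{k=1}^{\infty}$ be a frame for $\mathcal{W}$ and let $0\le\epsilon<1$. Then any $\epsilon$-approximate oblique dual frame $\mathcal{G}=\{g_k\}_{k=1}^{\infty}\subset\mathcal{V}$ of $\mathcal{F}$ in $\mathcal{V}$ is of the form $$\{g_k\}_{k=1}^{\infty}=\Big\{\pi_{\mathcal{V}\mathcal{W}^{\perp}}S_{\mathcal{F}}^{\dagger}f_k+h_k-\sum_{j=1}^{\infty}\langle S_{\mathcal{F}}^{\dagger}f_k,f_j\rangle h_j+r_k\Big\}_{k=1}^{\infty},$$ where $\{h_k\}_{k=1}^{\infty}$ and $\{r_k\}_{k=1}^{\infty}$ are Bessel sequences in $\mathcal{V}$ and $\big\|\sum_{k=1}^{\infty}\langle f,f_k\rangle r_k\big\|\le\epsilon\|f\|$ for all $f\in\mathcal{H}$.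
   Context: The direct sum $\mathcal{H}=\mathcal{W}\oplus\mathcal{V}^{\perp}$ (equivalently $\mathcal{H}=\mathcal{V}\oplus\mathcal{W}^{\perp}$) is not assumed orthogonal. $\pi_{\mathcal{W}\mathcal{V}^{\perp}}$ denotes the oblique projection onto $\mathcal{W}$ along $\mathcal{V}^{\perp}$ (identity on $\mathcal{W}$, zero on $\mathcal{V}^{\perp}$); similarly $\pi_{\mathcal{V}\mathcal{W}^{\perp}}$ is the projection onto $\mathcal{V}$ along $\mathcal{W}^{\perp}$. A sequence $\{f_k\}_{k=1}^{\infty}\subset\mathcal{W}$ is a Bessel sequence for (in) $\mathcal{W}$ if there is $\beta<\infty$ with $\sum_k|\langle f,f_k\rangle|^2\le\beta\|f\|^2$ for all $f\in\mathcal{W}$; it is a frame for $\mathcal{W}$ if moreover $\alpha\|f\|^2\le\sum_{k}|\langle f,f_k\rangle|^2$ for all $f\in\mathcal{W}$ and some $\alpha>0$. For a Bessel sequence $\mathcal{F}=\{f_k\}$, $T_{\mathcal{F}}:\ell^2\to\mathcal{H}$, $T_{\mathcal{F}}\{c_k\}=\sum_k c_kf_k$ is the synthesis operator, $T_{\mathcal{F}}^{*}f=\{\langle f,f_k\rangle\}_k$, and $S_{\mathcal{F}}=T_{\mathcal{F}}T_{\mathcal{F}}^{*}$ is the frame operator. $S^{\dagger}$ denotes the Moore–Penrose pseudo-inverse of a closed-range bounded operator $S$. Frames $\mathcal{F}$ for $\mathcal{W}$ and $\mathcal{G}$ for $\mathcal{V}$ are $\epsilon$-approximate oblique dual frames (and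 $\mathcal{G}$ is an $\epsilon$-approximate oblique dual frame of $\mathcal{F}$ in $\mathcal{V}$) if $\|\pi_{\mathcal{W}\mathcal{V}^{\perp}}-T_{\mathcal{F}}T_{\mathcal{G}}^{*}\|\le\epsilon$ or, equivalently, $\|\pi_{\mathcal{V}\mathcal{W}^{\perp}}-T_{\mathcal{G}}T_{\mathcal{F}}^{*}\|\le\epsilon$. *)

(* Defs.v *)
From mathcomp Require Import all_boot all_order all_algebra.
From mathcomp Require Import complex.
From mathcomp Require Import all_classical all_reals all_analysis.

Set Implicit Arguments.
Unset Strict Implicit.
Unset Printing Implicit Defensive.

Import Order.TTheory GRing.Theory Num.Theory.
Import numFieldNormedType.Exports.

Local Open Scope classical_set_scope.
Local Open Scope ring_scope.

Inductive scalar_kind := RealScalars | ComplexScalars.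

Definition scalars (R : realType) (s : scalar_kind) : numFieldType :=
  match s with
  | RealScalars => R
  | ComplexScalars => R[i]
  end.

Definition sconj (R : realType) (s : scalar_kind) :
    scalars R s -> scalars R s :=
  match s return scalars R s -> scalars R s with
  | RealScalars => idfun
  | ComplexScalars => @Num.conj R[i]
  end.

Definition sre (R : realType) (s : scalar_kind) : scalars R s -> R :=
  match s return scalars R s -> R with
  | RealScalars => idfun
  | ComplexScalars => @complex.Re R
  end.

(* The inner product is linear in its first argument and conjugate-linear in
   the second. *)
Record hilbertSpace (R : realType) (s : scalar_kind) := HilbertSpace {
  hcarrier :> completeNormedModType (scalars R s);
  inner : {dot hcarrier for @sconj R s};
  inner_norm : forall x : hcarrier, `|x| ^+ 2 = inner x x }.

Definition separable (T : topologicalType) : Prop :=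
  exists2 A : set T, countable A & dense A.

Section Hilbert.
Variables (R : realType) (s : scalar_kind) (H : hilbertSpace R s).
Local Notation K := (scalars R s).
Local Notation "''[' u , v ]" := (inner H u v) : ring_scope.

(* In the library a norm takes its values in the scalar field; [sabs] and
   [hnorm] are the same values, read in R. *)
Definition sabs (z : K) : R := sre `|z|.
Definition hnorm (x : H) : R := sre `|x|.

Definition closed_subspace (W : set H) : Prop :=
  [/\ W 0, forall (a : K) (x y : H), W x -> W y -> W (a *: x + y) & closed W].

Definition orth (V : set H) : set H :=
  [set x | forall v, V v -> '[x, v] = 0].

Definition direct_sum (W U : set H) : Prop :=
  (forall x, exists w u, [/\ W w, U u & x = w + u]) /\ W `&` U = [set 0].

(* The projection onto W along U; meaningful when [direct_sum W U]. *)
Definition oblique_proj (W U : set H) (x : H) : H :=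
  get [set w | W w /\ U (x - w)].

Definition opnorm (A : H -> H) : \bar R :=
  ereal_sup [set (hnorm (A x))%:E | x in [set x : H | hnorm x <= 1]].

Definition analysis_op (F : nat -> H) (f : H) : nat -> K :=
  fun k => '[f, F k].

(* Defined on every scalar sequence; it is the synthesis operator when F is
   Bessel and c is square-summable, in which case the series converges. *)
Definition synthesis_op (F : nat -> H) (c : nat -> K) : H :=
  limn (series (fun k => c k *: F k)).

Definition frame_op (F : nat -> H) : H -> H :=
  synthesis_op F \o analysis_op F.

Definition coef_energy (F : nat -> H) (f : H) : \bar R :=
  (\sum_(0 <= k <oo) ((sabs (analysis_op F f k)) ^+ 2)%:E)%E.

Definition bessel_seq (W : set H) (F : nat -> H) : Prop :=
  (forall k, W (F k)) /\
  exists beta : R, forall f, W f ->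
    (coef_energy F f <= (beta * hnorm f ^+ 2)%:E)%E.

Definition frame (W : set H) (F : nat -> H) : Prop :=
  bessel_seq W F /\
  exists2 alpha : R, 0 < alpha & forall f, W f ->
    ((alpha * hnorm f ^+ 2)%:E <= coef_energy F f)%E.

Definition self_adjoint (A : H -> H) : Prop :=
  forall f g, '[A f, g] = '[f, A g].

(* The four Penrose equations, for X a bounded operator. *)
Definition is_pseudo_inverse (S X : H -> H) : Prop :=
  [/\ linear X, continuous X,
      S \o X \o S = S /\ X \o S \o X = X,
      self_adjoint (S \o X) &
      self_adjoint (X \o S)].

(* Determined by the equations whenever S is bounded linear with closed
   range. *)
Definition pseudo_inverse (S : H -> H) : H -> H :=
  get [set X | is_pseudo_inverse S X].

Definition approx_oblique_dual (eps : R) (W V : set H) (F G : nat -> H) :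
    Prop :=
  [/\ frame W F, frame V G &
      (opnorm (fun f => (oblique_proj W (orth V) f
                         - synthesis_op F (analysis_op G f))%R)
       <= eps%:E)%E].

End Hilbert.

(* Main.v *)
(* The approximate dual itself serves as [h]: with [A = T_G T_F^*], the term
   [sum_j <S^+ f_k, f_j> h_j] is [A S^+ f_k], so the required identity forces
   [r_k = (A - pi_(V,W^perp)) S^+ f_k].  Since [A - pi_(V,W^perp)] is the adjoint
   of [T_F T_G^* - pi_(W,V^perp)] it has norm at most [eps], and since it vanishes
   on [W^perp] and [S^+ S] is the orthogonal projection onto [W], one gets
   [sum_k <f, f_k> r_k = (A - pi_(V,W^perp)) f].

   No projection theorem, Riesz representation or closed graph theorem is used.
   The lower frame bound makes [S] invertible on [W] by a contraction argument;
   then [f = w + (f - w)] with [w] in [W] and [S w = S f] is the decomposition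
   along [W] and [W^perp], and [S^+ f] is the [w] in [W] with [f - S w] in
   [W^perp].  A second contraction, which uses [eps < 1], gives
   [H = V + W^perp]. *)

Require Import Defs.
From mathcomp Require Import all_boot all_order all_algebra.
From mathcomp Require Import complex.
From mathcomp Require Import all_classical all_reals all_analysis.
From mathcomp Require Import ring lra.

Set Implicit Arguments.
Unset Strict Implicit.
Unset Printing Implicit Defensive.

Import Order.TTheory GRing.Theory Num.Theory.
Import numFieldNormedType.Exports.

Local Open Scope classical_set_scope.
Local Open Scope ring_scope.

(** * Scalars *)

Section Scalars.
Variables (R : realType) (s : scalar_kind).
Local Notation K := (scalars R s).

(** Norm facts of the library live in [K]. This order embedding, with left inverse [sre], carries
    them to [R]. *)
Definition sreal : R -> K :=
  match s return R -> scalars R s with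
  | RealScalars => idfun
  | ComplexScalars => @real_complex_def R (Phant R)
  end.

Lemma srealK : cancel sreal (@sre R s).
Proof. by rewrite /sreal /sre; case: s. Qed.

Lemma sreal0 : sreal 0 = 0.
Proof. by rewrite /sreal; case: s. Qed.

Lemma ler_sreal x y : (sreal x <= sreal y) = (x <= y).
Proof. by rewrite /sreal; case: s => //=; rewrite lecR. Qed.

Lemma ltr_sreal x y : (sreal x < sreal y) = (x < y).
Proof. by rewrite /sreal; case: s => //=; rewrite ltcR. Qed.

Lemma srealM : {morph sreal : x y / x * y}.
Proof. by rewrite /sreal; case: s => //= x y; rewrite rmorphM. Qed.

Lemma srealD : {morph sreal : x y / x + y}.
Proof. by rewrite /sreal; case: s => //= x y; rewrite rmorphD. Qed.

(** In the order on [R[i]] a nonnegative element has zero imaginary part. *)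
Lemma ger0_sreal (a : K) : 0 <= a -> a = sreal (sre a).
Proof.
rewrite /sreal /sre; move: a; case: s => //= a a0.
by rewrite RRe_real// ger0_real.
Qed.

Lemma normr_sabs (a : K) : `|a| = sreal (sabs a).
Proof. exact: ger0_sreal. Qed.

Lemma sreD : {morph @sre R s : x y / x + y}.
Proof. by rewrite /sre; case: s => //= x y; rewrite raddfD. Qed.

Lemma sreN : {morph @sre R s : x / - x}.
Proof. by rewrite /sre; case: s => //= x; rewrite raddfN. Qed.

Lemma sreB : {morph @sre R s : x y / x - y}.
Proof. by move=> x y; rewrite sreD sreN. Qed.

Lemma sre0 : sre (0 : K) = 0.
Proof. by rewrite -sreal0 srealK. Qed.

Lemma sre_sum I (r : seq I) (P : pred I) (F : I -> K) :
  sre (\sum_(i <- r | P i) F i) = \sum_(i <- r | P i) sre (F i).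
Proof. exact: (big_morph _ sreD sre0). Qed.

Lemma sreMl (t : R) (a : K) : sre (sreal t * a) = t * sre a.
Proof.
rewrite /sreal /sre; move: a; case: s => //= -[x y].
by rewrite /= mul0r subr0.
Qed.

Lemma sre_le_sabs (a : K) : sre a <= sabs a.
Proof.
rewrite /sabs /sre; move: a; case: s => /= a; first exact: ler_norm.
apply: le_trans (ler_norm _) _.
by have := normc_ge_Re a; rewrite lecE /= => /andP[_].
Qed.

Lemma sabsM (a b : K) : sabs (a * b) = sabs a * sabs b.
Proof.
by apply: (can_inj srealK); rewrite srealM -!normr_sabs normrM.
Qed.

Lemma sabs_eq0 (a : K) : sabs a <= 0 -> a = 0.
Proof.
by rewrite -ler_sreal -normr_sabs sreal0 normr_le0 => /eqP.
Qed.

Lemma sabs_sreal t : 0 <= t -> sabs (sreal t) = t.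
Proof.
move=> t0; apply: (can_inj srealK); rewrite -normr_sabs ger0_norm//.
by rewrite -sreal0 ler_sreal.
Qed.

Lemma ler_sabsB (a b : K) : sabs (a - b) <= sabs a + sabs b.
Proof. by rewrite -(ler_sreal) srealD -!normr_sabs ler_normB. Qed.

Lemma sabs_sconj (a : K) : sabs (sconj a) = sabs a.
Proof.
rewrite /sabs /sconj; move: a; case: s => //= a.
exact: (congr1 (@complex.Re R) (@norm_conjC R[i] a)).
Qed.

Lemma mul_sconj (a : K) : a * sconj a = sreal (sabs a ^+ 2).
Proof.
rewrite expr2 srealM -normr_sabs -expr2.
rewrite /sconj; move: a; case: s => //= a; last exact: esym (@normCK R[i] a).
by rewrite -normrX ger0_norm ?sqr_ge0.
Qed.

Lemma sre_sconj (a : K) : sre (sconj a) = sre a.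
Proof.
rewrite /sre /sconj; move: a; case: s => //= a; apply: complexI.
by rewrite !complexRe Re_conj.
Qed.
End Scalars.

(** * Inner product, norm and limits *)

Lemma cvg0_le (R : realType) (d : nat -> R) (a b : R) : d @ \oo --> 0 ->
  (\forall n \near \oo, a <= b + d n) -> a <= b.
Proof.
move=> d0 le_ab.
have bd : (fun n => b + d n) @ \oo --> b.
  by rewrite -[X in _ --> X]addr0; apply: cvgD => //; exact: cvg_cst.
have <- : limn (fun n => b + d n) = b by exact/cvg_lim.
by apply: limr_ge => //; apply/cvg_ex; exists b.
Qed.

Section Inner.
Variables (R : realType) (s : scalar_kind) (H : hilbertSpace R s).
Local Notation K := (scalars R s).
Implicit Types (x y z : H) (a : K).

Lemma innerDl x y z : inner H (x + y) z = inner H x z + inner H y z.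
Proof. exact: linearDl. Qed.

Lemma innerDr x y z : inner H x (y + z) = inner H x y + inner H x z.
Proof. exact: linearDr. Qed.

Lemma innerNl x y : inner H (- x) y = - inner H x y.
Proof. exact: linearNl. Qed.

Lemma innerNr x y : inner H x (- y) = - inner H x y.
Proof. exact: linearNr. Qed.

Lemma innerBl x y z : inner H (x - y) z = inner H x z - inner H y z.
Proof. exact: linearBl. Qed.

Lemma innerBr x y z : inner H x (y - z) = inner H x y - inner H x z.
Proof. exact: linearBr. Qed.

Lemma inner0l x : inner H 0 x = 0.
Proof. exact: linear0l. Qed.

Lemma inner0r x : inner H x 0 = 0.
Proof. exact: linear0r. Qed.

Lemma innerZl a x y : inner H (a *: x) y = a * inner H x y.
Proof. exact: linearZl_LR. Qed.

Lemma innerZr a x y : inner H x (a *: y) = sconj a * inner H x y.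
Proof. exact: linearZr_LR. Qed.

Lemma inner_suml I (r : seq I) (P : pred I) (E : I -> H) y :
  inner H (\sum_(i <- r | P i) E i) y = \sum_(i <- r | P i) inner H (E i) y.
Proof. exact: linear_sumlz. Qed.

Lemma inner_sumr I (r : seq I) (P : pred I) (E : I -> H) y :
  inner H y (\sum_(i <- r | P i) E i) = \sum_(i <- r | P i) inner H y (E i).
Proof. exact: linear_sumr. Qed.

Lemma inner_conj x y : sconj (inner H y x) = inner H x y.
Proof. by have := hermitian_subproof (s := inner H) x y; rewrite expr0 mul1r => ->. Qed.

Lemma inner_eq0C x y : inner H x y = 0 -> inner H y x = 0.
Proof.
move=> xy0; apply: sabs_eq0.
by rewrite -inner_conj xy0 sabs_sconj /sabs normr0 sre0.
Qed.

Lemma normr_hnorm x : `|x| = sreal s (hnorm x).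
Proof. exact: ger0_sreal. Qed.

Lemma hnorm_ge0 x : 0 <= hnorm x.
Proof. by rewrite -(@ler_sreal _ s) -normr_hnorm sreal0. Qed.

Lemma hnormZ a x : hnorm (a *: x) = sabs a * hnorm x.
Proof.
apply: (can_inj (@srealK _ s)).
by rewrite srealM -normr_hnorm normrZ normr_sabs normr_hnorm.
Qed.

Lemma ler_hnormD x y : hnorm (x + y) <= hnorm x + hnorm y.
Proof. by rewrite -(@ler_sreal _ s) srealD -!normr_hnorm ler_normD. Qed.

Lemma hnorm_opp x : hnorm (- x) = hnorm x.
Proof. by rewrite /hnorm normrN. Qed.

Lemma hnorm0 : hnorm (0 : H) = 0.
Proof. by rewrite /hnorm normr0 sre0. Qed.

Lemma hnorm_le0 x : hnorm x <= 0 -> x = 0.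
Proof. by rewrite -(@ler_sreal _ s) -normr_hnorm sreal0 normr_le0 => /eqP. Qed.

Lemma inner_hnorm x : inner H x x = sreal s (hnorm x ^+ 2).
Proof. by rewrite -inner_norm normr_hnorm !expr2 srealM. Qed.

Lemma hnorm_sqr x : hnorm x ^+ 2 = sre (inner H x x).
Proof. by rewrite inner_hnorm srealK. Qed.

Lemma sre_innerC x y : sre (inner H x y) = sre (inner H y x).
Proof. by rewrite -inner_conj sre_sconj. Qed.

Lemma hnorm_sqrB x y :
  hnorm (x - y) ^+ 2 = hnorm x ^+ 2 - 2 * sre (inner H x y) + hnorm y ^+ 2.
Proof.
rewrite !hnorm_sqr innerBl !innerBr !sreB (sre_innerC y x); ring.
Qed.

Lemma sre_innerZl (t : R) x y : sre (inner H (sreal s t *: x) y) = t * sre (inner H x y).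
Proof. by rewrite innerZl sreMl. Qed.

Lemma sre_inner_le x y : sre (inner H x y) <= hnorm x * hnorm y.
Proof.
have [y0|y0] := leP (hnorm y) 0.
  by rewrite (hnorm_le0 y0) inner0r sre0 hnorm0 mulr0.
have [x0|x0] := leP (hnorm x) 0.
  by rewrite (hnorm_le0 x0) inner0l sre0 hnorm0 mul0r.
(* Expanded, this square is [2 |x| |y| (|x| |y| - Re <x, y>)]. *)
have := sqr_ge0 (hnorm (sreal s (hnorm y) *: x - sreal s (hnorm x) *: y)).
rewrite hnorm_sqrB !hnormZ !sabs_sreal ?hnorm_ge0// sre_innerZl.
rewrite sre_innerC sre_innerZl sre_innerC => h.
rewrite -(ler_pM2l (mulr_gt0 x0 y0)); nra.
Qed.

(** Multiplying [x] by the conjugate of [z = <x, y>] turns the inner product into [|z|^2], so the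
    bound on real parts applies and one factor [|z|] cancels. *)
Lemma sabs_inner_le x y : sabs (inner H x y) <= hnorm x * hnorm y.
Proof.
set z := inner H x y; have [z0|z0] := leP (sabs z) 0.
  by apply: le_trans z0 _; rewrite mulr_ge0 ?hnorm_ge0.
have := sre_inner_le (sconj z *: x) y.
rewrite innerZl -/z mulrC mul_sconj srealK hnormZ sabs_sconj -mulrA expr2.
by rewrite ler_pM2l.
Qed.

Lemma hnorm_sqr_le0 x : hnorm x ^+ 2 <= 0 -> x = 0.
Proof. by rewrite exprn_even_le0//= => /eqP x0; apply: hnorm_le0; rewrite x0. Qed.

Lemma inner_eq0 x : inner H x x = 0 -> x = 0.
Proof. by move=> xx0; apply: hnorm_sqr_le0; rewrite hnorm_sqr xx0 sre0. Qed.

Lemma inner_ext x y : (forall z, inner H x z = inner H y z) -> x = y.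
Proof.
move=> xy; apply/eqP; rewrite -subr_eq0; apply/eqP/inner_eq0.
by rewrite innerBl xy subrr.
Qed.

Lemma cvg_hnormP (u : nat -> H) x :
  u @ \oo --> x <-> (fun n => hnorm (x - u n)) @ \oo --> 0.
Proof.
split=> [/cvgrPdist_lt ux|/cvgrPdist_lt ux]; apply/cvgrPdist_lt => e e0.
  have /ux : 0 < sreal s e by rewrite -[ltLHS](@sreal0 _ s) ltr_sreal.
  apply: filterS => n; rewrite normr_hnorm ltr_sreal sub0r normrN.
  by rewrite ger0_norm ?hnorm_ge0.
rewrite (ger0_sreal (ltW e0)).
have /ux : 0 < sre e.
  by rewrite -(@ltr_sreal _ s) -ger0_sreal ?ltW// sreal0.
apply: filterS => n; rewrite normr_hnorm ltr_sreal sub0r normrN.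
by rewrite ger0_norm ?hnorm_ge0.
Qed.

Lemma hnorm_cvg_le (u : nat -> H) x (a b C : R) : u @ \oo --> x ->
  (\forall n \near \oo, a <= b + C * hnorm (x - u n)) -> a <= b.
Proof.
move=> /cvg_hnormP ux; apply: cvg0_le.
by rewrite -[X in _ --> X](mulr0 C); exact: cvgMr.
Qed.

(** Continuity of the inner product, in the form that carries an adjoint relation from partial sums
    to their limits. *)
Lemma inner_cvg_eq (u v : nat -> H) x y (x' y' : H) :
  u @ \oo --> x -> v @ \oo --> y ->
  (forall n, inner H (u n) x' = inner H y' (v n)) ->
  inner H x x' = inner H y' y.
Proof.
move=> /cvg_hnormP ux /cvg_hnormP vy uv.
apply/eqP; rewrite -subr_eq0; apply/eqP/sabs_eq0.
pose d n := hnorm x' * hnorm (x - u n) + hnorm y' * hnorm (y - v n).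
apply: (@cvg0_le _ d).
  rewrite -[X in _ --> X]addr0 -[X in _ --> X + _](mulr0 (hnorm x')).
  by rewrite -[X in _ --> _ + X](mulr0 (hnorm y')); apply: cvgD; exact: cvgMr.
apply: nearW => n; rewrite add0r /d.
have -> : inner H x x' - inner H y' y =
    inner H (x - u n) x' - inner H y' (y - v n).
  rewrite innerBl innerBr uv; ring.
rewrite mulrC; apply: le_trans (lerD (sabs_inner_le _ _) (sabs_inner_le _ _)).
exact: ler_sabsB.
Qed.

(** Exponent 1 serves domination by a geometric series, exponent 2 the synthesis series, whose
    blocks are bounded in squared norm. *)
Lemma cauchy_series_hilbert (u : nat -> H) (v : nat -> R) p :
  (forall m n, hnorm (\sum_(m <= k < n) u k) ^+ p.+1
               <= \sum_(m <= k < n) v k) ->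
  cvgn (series v) -> cvgn (series u).
Proof.
move=> uv /cauchy_cvgP/cauchy_seriesP cv.
apply/cauchy_cvgP/cauchy_seriesP => e e0.
rewrite (ger0_sreal (ltW e0)).
have e'0 : 0 < sre e.
  by rewrite -(@ltr_sreal _ s) -ger0_sreal ?ltW// sreal0.
have := cv _ (exprn_gt0 p.+1 e'0).
apply: filterS => -[m n] /= mn; rewrite normr_hnorm ltr_sreal.
rewrite -(@ltr_pXn2r _ p.+1)// ?nnegrE ?hnorm_ge0 ?ltW//.
exact: le_lt_trans (uv _ _) (le_lt_trans (ler_norm _) mn).
Qed.

End Inner.

(** * Subspaces and oblique projections *)

Section Subspaces.
Variables (R : realType) (s : scalar_kind) (H : hilbertSpace R s).
Local Notation K := (scalars R s).
Implicit Types (x y z : H) (a : K) (W U : set H).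

(* Closedness plays no role in the algebra of oblique projections. *)
Definition lin_subspace (W : set H) : Prop :=
  W 0 /\ forall a x y, W x -> W y -> W (a *: x + y).

Lemma closed_subspace_lin W : closed_subspace W -> lin_subspace W.
Proof. by case. Qed.

Lemma subspace_orth W : lin_subspace (orth W).
Proof.
split=> [v _|a x y Wx Wy v Wv]; first exact: inner0l.
by rewrite innerDl innerZl Wx// Wy// mulr0 addr0.
Qed.

Section SubspaceTheory.
Variables (W : set H) (subW : lin_subspace W).

Lemma subspaceZ a x : W x -> W (a *: x).
Proof. by move=> Wx; rewrite -[_ *: _]addr0; apply: subW.2 => //; exact: subW.1. Qed.

Lemma subspaceD x y : W x -> W y -> W (x + y).
Proof. by move=> Wx Wy; rewrite -[x]scale1r; exact: subW.2. Qed.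

Lemma subspaceN x : W x -> W (- x).
Proof. by move=> Wx; rewrite -scaleN1r; exact: subspaceZ. Qed.

Lemma subspaceB x y : W x -> W y -> W (x - y).
Proof. by move=> Wx Wy; apply: subspaceD => //; exact: subspaceN. Qed.

Lemma subspace_sum I (r : seq I) (P : pred I) (E : I -> H) :
  (forall i, W (E i)) -> W (\sum_(i <- r | P i) E i).
Proof.
by move=> WE; apply: (big_ind W) => //; [exact: subW.1|exact: subspaceD].
Qed.

End SubspaceTheory.

Lemma closed_subspace_limn W (u : nat -> H) :
  closed_subspace W -> (forall n, W (u n)) -> cvgn u -> W (limn u).
Proof.
move=> [_ _ cW] Wu; apply: (@closed_cvg _ _ \oo _ u W cW).
exact: nearW.
Qed.

(** * Oblique projections and their adjoints *)

Section ObliqueProjection.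
Variables W U : set H.
Hypotheses (subW : lin_subspace W) (subU : lin_subspace U) (WU : direct_sum W U).

Lemma oblique_projP x : W (oblique_proj W U x) /\ U (x - oblique_proj W U x).
Proof.
have [w [u [Ww Uu xwu]]] := WU.1 x.
apply: (@getPex _ [set w | W w /\ U (x - w)]); exists w.
by split=> //; rewrite xwu addrC addKr.
Qed.

Lemma oblique_proj_eq x w : W w -> U (x - w) -> oblique_proj W U x = w.
Proof.
move=> Ww Uw; have [Wp Up] := oblique_projP x.
have : (W `&` U) (oblique_proj W U x - w).
  split; first exact: subspaceB.
  rewrite (_ : _ - w = (x - w) - (x - oblique_proj W U x)); last first.
    by rewrite opprB [RHS]addrC addrA subrK.
  exact: subspaceB.
by rewrite WU.2 => /eqP; rewrite subr_eq0 => /eqP.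
Qed.

Lemma oblique_proj_linear : linear (oblique_proj W U).
Proof.
move=> a x y; have [Wx Ux] := oblique_projP x; have [Wy Uy] := oblique_projP y.
apply: oblique_proj_eq; first exact: subW.2.
rewrite opprD addrACA -scalerBr; exact: subU.2.
Qed.

End ObliqueProjection.

(** Both sides equal the inner product of the two projections: [x - q] is orthogonal to [W] and
    [y - p] to [V]. *)
Lemma inner_oblique_proj W V x y :
  direct_sum W (orth V) -> direct_sum V (orth W) ->
  inner H (oblique_proj V (orth W) x) y = inner H x (oblique_proj W (orth V) y).
Proof.
move=> WV VW; have [Wp Vp] := oblique_projP WV y.
have [Vq Wq] := oblique_projP VW x.
set p := oblique_proj W _ _ in Wp Vp *; set q := oblique_proj V _ _ in Vq Wq *.
transitivity (inner H q p).
  by apply/eqP; rewrite -subr_eq0 -innerBr (inner_eq0C (Vp _ Vq)).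
by apply/esym/eqP; rewrite -subr_eq0 -innerBl Wq.
Qed.

(* Summing the residuals [y - D x_n] of the iteration
   [x_(n+1) = x_n + (y - D x_n)] yields the solution. *)
Lemma surj_near_identity W (D : H -> H) (q : R) :
  closed_subspace W -> 0 <= q -> q < 1 ->
  (forall x y, D (x + y) = D x + D y) -> (forall x, W x -> W (D x)) ->
  (forall x, W x -> hnorm (x - D x) <= q * hnorm x) ->
  forall y, W y -> exists2 x, W x & D x = y.
Proof.
move=> cW q0 q1 DD WD Dq y Wy; have subW := closed_subspace_lin cW.
pose r n := iter n (fun z => z - D z) y.
have Wr n : W (r n).
  by elim: n => //= n Wrn; apply: subspaceB => //; exact: WD.
have rq n : hnorm (r n) <= hnorm y * q ^+ n.
  elim: n => [|n IH]; first by rewrite expr0 mulr1.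
  apply: le_trans (Dq _ (Wr n)) _.
  by rewrite exprS mulrCA ler_wpM2l.
have sr_cvg : cvgn (series r).
  apply: (@cauchy_series_hilbert _ _ _ _ (geometric (hnorm y) q) 0) => [m n|].
    rewrite expr1; elim/big_ind2 : _ => [|x1 x2 y1 y2 h1 h2|i _ //].
      by rewrite hnorm0.
    exact: le_trans (ler_hnormD _ _) (lerD h1 h2).
  by apply: is_cvg_geometric_series; rewrite ger0_norm.
have Wsr n : W (series r n) by exact: subspace_sum.
exists (limn (series r)); first exact: closed_subspace_limn.
have D0 : D 0 = 0 by apply: (addrI (D 0)); rewrite -DD !addr0.
(* The sum telescopes, since [D (r n) = r n - r n.+1]. *)
have Dsr n : D (series r n) = y - r n.
  elim: n => [|n IH]; first by rewrite /series/= big_geq// D0 subrr.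
  by rewrite seriesSr DD IH /= opprB addrA addrAC.
have DB u v : D (u - v) = D u - D v.
  by apply: (addIr (D v)); rewrite -DD !subrK.
set x := limn _; have Wx : W x by exact: closed_subspace_limn.
apply/eqP; rewrite -subr_eq0; apply/eqP/hnorm_le0.
(* The contraction hypothesis bounds [D] by [1 + q] on [W], which supplies the continuity needed to
   pass to the limit. *)
apply: (@cvg0_le _ (fun n => (1 + q) * hnorm (x - series r n)
                             + hnorm y * q ^+ n)).
  rewrite -[X in _ --> X]addr0 -[X in _ --> X + _](mulr0 (1 + q)).
  apply: cvgD; first by apply: cvgMr; exact/cvg_hnormP.
  rewrite -[X in _ --> X](mulr0 (hnorm y)).
  by apply: cvgMr; apply: cvg_expr; rewrite ger0_norm.
apply: nearW => n; rewrite add0r.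
have -> : D x - y = D (x - series r n) - r n.
  by rewrite DB Dsr opprB addrA addrAC addrK.
apply: le_trans (ler_hnormD _ _) (lerD _ _); last by rewrite hnorm_opp.
set z := x - _; rewrite (_ : D z = z - (z - D z)); last first.
  by rewrite opprB addrC subrK.
apply: le_trans (ler_hnormD _ _) _.
rewrite hnorm_opp mulrDl mul1r lerD2l; apply: Dq; exact: subspaceB.
Qed.

End Subspaces.

(** * Bessel sequences *)

Section BesselSequences.
Variables (R : realType) (s : scalar_kind) (H : hilbertSpace R s).
Local Notation K := (scalars R s).
Implicit Types (x y f : H) (F G : nat -> H) (W : set H).

Lemma coef_energy_leP F f (M : R) :
  (coef_energy F f <= M%:E)%E <->
  forall m n, \sum_(m <= k < n) sabs (analysis_op F f k) ^+ 2 <= M.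
Proof.
have ge0 n : (0 <= n)%N -> true ->
    (0 <= (sabs (analysis_op F f n) ^+ 2)%:E)%E by rewrite lee_fin sqr_ge0.
split=> [le_M m n|le_M]; last first.
  apply: lime_le; first exact: is_cvg_nneseries.
  by apply: nearW => n; rewrite sumEFin lee_fin.
rewrite -lee_fin -sumEFin; apply: le_trans le_M.
apply: le_trans (@nneseries_lim_ge _ _ xpredT 0 n _); last exact: ge0.
rewrite !sumEFin lee_fin; have [mn|nm] := leqP m n.
  by rewrite [leRHS](@big_cat_nat _ _ _ m)//= lerDr sumr_ge0// => i _; rewrite sqr_ge0.
by rewrite (big_geq (ltnW nm)) sumr_ge0// => i _; rewrite sqr_ge0.
Qed.

(** [b] bounds the square of the norm of [T_F]. Finite blocks presuppose no convergence and feed the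
    Cauchy criterion directly. *)
Definition synthesis_bounded (b : R) F : Prop := forall (c : nat -> K) m n,
  hnorm (\sum_(m <= k < n) c k *: F k) ^+ 2
  <= b * \sum_(m <= k < n) sabs (c k) ^+ 2.

(** A duality argument: [|y|^2] is the sum of the [c k <F k, y>], and the Bessel inequality is
    applied at [y] itself, which lies in [W]. *)
Lemma bessel_synthesis_bounded W F : lin_subspace W -> bessel_seq W F ->
  exists2 b : R, 0 < b & synthesis_bounded b F.
Proof.
move=> subW [WF [b0 b0P]].
have [b b_gt0 bP] : exists2 b : R, 0 < b & forall f m n, W f ->
    \sum_(m <= k < n) sabs (analysis_op F f k) ^+ 2 <= b * hnorm f ^+ 2.
  (* The Bessel constant carries no sign, while [b] is divided by below. *)
  exists (`|b0| + 1); first by rewrite ltr_wpDl.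
  move=> f m n Wf; apply: le_trans (_ : b0 * hnorm f ^+ 2 <= _).
    exact: (proj1 (coef_energy_leP _ _ _) (b0P f Wf)).
  by rewrite ler_wpM2r ?sqr_ge0// (le_trans (ler_norm _))// lerDl.
exists b => // c m n; set y := \sum_(_ <= _ < _) _.
have Wy : W y by apply: (subspace_sum subW) => k; exact: subspaceZ.
have y_le : hnorm y ^+ 2 <=
    \sum_(m <= k < n) (b / 2 * sabs (c k) ^+ 2
                       + (2 * b)^-1 * sabs (analysis_op F y k) ^+ 2).
  rewrite hnorm_sqr {1}/y inner_suml sre_sum; apply: ler_sum => k _.
  rewrite innerZl; apply: le_trans (sre_le_sabs _) _.
  rewrite sabsM -inner_conj sabs_sconj -/(analysis_op F y k).
  set u := sabs (c k); set v := sabs _.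
  (* AM-GM: [u v <= (b u^2 + v^2 / b) / 2] *)
  rewrite -subr_ge0.
  have -> : b / 2 * u ^+ 2 + (2 * b)^-1 * v ^+ 2 - u * v
      = (2 * b)^-1 * (b * u - v) ^+ 2 by field; rewrite gt_eqF.
  by rewrite mulr_ge0 ?sqr_ge0// invr_ge0 mulr_ge0 ?ltW.
move: y_le; rewrite big_split/= -!mulr_sumr.
set Sc := \sum_(_ <= _ < _) sabs (c _) ^+ 2.
(* The weight in the AM-GM step is chosen so that this half is absorbed by [|y|^2]. *)
have : (2 * b)^-1 * \sum_(m <= i < n) sabs (analysis_op F y i) ^+ 2
    <= hnorm y ^+ 2 / 2.
  apply: le_trans (_ : (2 * b)^-1 * (b * hnorm y ^+ 2) <= _).
    by rewrite ler_pM2l ?bP// invr_gt0 mulr_gt0.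
  by rewrite invfM -mulrA mulKf ?gt_eqF// mulrC.
lra.
Qed.

Section SynthesisBound.
Variables (b : R) (F : nat -> H).
Hypotheses (b_gt0 : 0 < b) (bF : synthesis_bounded b F).

(* The synthesis bound does not mention [W]: through it, a Bessel inequality on
   [W] extends to all of [H]. *)
Lemma coef_energy_le f : (coef_energy F f <= (b * hnorm f ^+ 2)%:E)%E.
Proof.
apply/coef_energy_leP => m n; set E := \sum_(_ <= _ < _) _.
pose y := \sum_(m <= k < n) analysis_op F f k *: F k.
have yE : sre (inner H f y) = E.
  rewrite sre_innerC inner_suml sre_sum; apply: eq_bigr => k _.
  by rewrite innerZl -(inner_conj (F k)) mul_sconj srealK.
have yb : hnorm y ^+ 2 <= b * E := bF _ _ _.
(* With [Re <f, y> = E] and [|y|^2 <= b E], expansion gives [0 <= b^2 |f|^2 - b E]. *)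
have := sqr_ge0 (hnorm (sreal s b *: f - y)).
rewrite hnorm_sqrB hnormZ sre_innerZl (sabs_sreal _ (ltW b_gt0)) yE => h.
by rewrite -(ler_pM2l b_gt0); nra.
Qed.

Lemma synthesis_cvg (c : nat -> K) (M : R) :
  (forall m n, \sum_(m <= k < n) sabs (c k) ^+ 2 <= M) ->
  cvgn (series (fun k => c k *: F k)).
Proof.
move=> cM.
apply: (@cauchy_series_hilbert _ _ _ _ (fun k => b * sabs (c k) ^+ 2) 1).
  by move=> m n; rewrite -mulr_sumr; exact: bF.
apply: is_cvg_seriesZ; apply: nondecreasing_is_cvgn.
  by apply: nondecreasing_series => n _ _; rewrite sqr_ge0.
by exists M => _ [n _ <-]; exact: cM.
Qed.

Lemma synthesis_le (c : nat -> K) (M : R) :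
  (forall m n, \sum_(m <= k < n) sabs (c k) ^+ 2 <= M) ->
  hnorm (synthesis_op F c) ^+ 2 <= b * M.
Proof.
move=> cM; have cv := synthesis_cvg cM.
have M0 : 0 <= M by have := cM 0%N 0%N; rewrite big_geq.
have bM0 : 0 <= b * M by rewrite mulr_ge0// ltW.
suff : hnorm (synthesis_op F c) <= Num.sqrt (b * M).
  by move=> h; rewrite -[leRHS]sqr_sqrtr// ler_pXn2r// nnegrE ?hnorm_ge0.
apply: (hnorm_cvg_le (C := 1) cv); apply: nearW => n; rewrite mul1r.
set t := series _ n; set x := limn _.
have -> : synthesis_op F c = t + (x - t) by rewrite addrC subrK.
apply: le_trans (ler_hnormD _ _) _; rewrite lerD2r.
rewrite -[leLHS]ger0_norm ?hnorm_ge0// -sqrtr_sqr ler_wsqrtr//.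
by apply: le_trans (bF _ _ _) _; rewrite ler_pM2l.
Qed.

End SynthesisBound.

(** The mixed operator [T_F T_G^*]; [frame_op F] is [cross_op F F] by conversion. *)
Definition cross_op F G : H -> H := synthesis_op F \o analysis_op G.

Section CrossOperator.
Variables (b b' : R) (F G : nat -> H).
Hypotheses (b_gt0 : 0 < b) (bF : synthesis_bounded b F).
Hypotheses (b'_gt0 : 0 < b') (bG : synthesis_bounded b' G).

Lemma cross_op_cvg f : cvgn (series (fun k => analysis_op G f k *: F k)).
Proof.
have /coef_energy_leP := coef_energy_le b'_gt0 bG f.
exact: synthesis_cvg.
Qed.

Lemma cross_op_linear : linear (cross_op F G).
Proof.
move=> a x y; apply/cvg_lim => //.
pose u z := series (fun k => analysis_op G z k *: F k).
rewrite (_ : series _ = (fun n => a *: u x n + u y n)); last first.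
  apply/funext => n; rewrite /u /series/= scaler_sumr -big_split/=.
  apply: eq_bigr => k _.
  by rewrite /analysis_op innerDl innerZl scalerDl scalerA.
apply: cvgD; last exact: cross_op_cvg.
by apply: cvgZr; exact: cross_op_cvg.
Qed.

Lemma cross_op_subspace W f : closed_subspace W -> (forall k, W (F k)) ->
  W (cross_op F G f).
Proof.
move=> cW WF; have subW := closed_subspace_lin cW.
suff Wn n : W (series (fun k => analysis_op G f k *: F k) n).
  exact: (closed_subspace_limn cW Wn (@cross_op_cvg f)).
by apply: (subspace_sum subW) => k; exact: subspaceZ.
Qed.

End CrossOperator.
Arguments cross_op_cvg {b b' F G} bF b'_gt0 bG f.

Lemma cross_op_adjoint b b' F G x y :
  0 < b -> synthesis_bounded b F -> 0 < b' -> synthesis_bounded b' G ->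
  inner H (cross_op F G x) y = inner H x (cross_op G F y).
Proof.
move=> b_gt0 bF b'_gt0 bG.
apply: (inner_cvg_eq (cross_op_cvg bF b'_gt0 bG x)
                     (cross_op_cvg bG b_gt0 bF y)) => n.
rewrite /series/= inner_suml inner_sumr; apply: eq_bigr => k _.
by rewrite innerZl innerZr mulrC /analysis_op inner_conj.
Qed.

(** Pairing the [p]-th partial sum of [S f] with [f] gives the energy of the first [p] coefficients,
    which dominates any block ending at [n <= p]. *)
Lemma coef_energy_le_frame_op b F f : 0 < b -> synthesis_bounded b F ->
  (coef_energy F f <= (sre (inner H (cross_op F F f) f))%:E)%E.
Proof.
move=> b_gt0 bF; apply/coef_energy_leP => m n.
have cv := cross_op_cvg bF b_gt0 bF f.
apply: (hnorm_cvg_le (C := hnorm f) cv); near=> p.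
set t := series _ p; set x := limn _.
have -> : cross_op F F f = t + (x - t) by rewrite addrC subrK.
apply: le_trans (_ : sre (inner H t f) <= _); last first.
  rewrite innerDl sreD -addrA lerDl addrC -lerBlDr sub0r -sreN -innerNl.
  by rewrite mulrC -(hnorm_opp (x - t)); exact: sre_inner_le.
rewrite inner_suml sre_sum.
under [leRHS]eq_bigr do
  rewrite innerZl /analysis_op -(inner_conj (F _)) mul_sconj srealK.
have [mn|nm] := leqP m n; last first.
  by rewrite (big_geq (ltnW nm)) sumr_ge0// => i _; rewrite sqr_ge0.
rewrite [leRHS](@big_cat_nat _ _ _ n)//=; last by near: p; exists n.
rewrite [X in X + _](@big_cat_nat _ _ _ m)//= addrAC lerDr.
by rewrite addr_ge0// sumr_ge0// => i _; rewrite sqr_ge0.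
Unshelve. all: end_near. Qed.

End BesselSequences.

(** * The frame operator and its pseudo-inverse *)

Section FrameOperator.
Variables (R : realType) (s : scalar_kind) (H : hilbertSpace R s).
Local Notation K := (scalars R s).
Implicit Types (x y f g : H).

Lemma linear_mapB (A : H -> H) : linear A -> forall x y, A (x - y) = A x - A y.
Proof. by move=> lA x y; rewrite addrC -scaleN1r lA scaleN1r addrC. Qed.

Lemma linear_map0 (A : H -> H) : linear A -> A 0 = 0.
Proof. by move=> /linear_mapB/(_ 0 0); rewrite !subrr. Qed.

Lemma linear_mapZ (A : H -> H) : linear A ->
  forall (a : K) x, A (a *: x) = a *: A x.
Proof. by move=> lA a x; rewrite -[a *: x]addr0 lA linear_map0// addr0. Qed.

Lemma bounded_linear_continuous (A : H -> H) (C : R) : linear A ->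
  (forall x, hnorm (A x) <= C * hnorm x) -> continuous A.
Proof.
move=> lA AC x; apply/cvgrPdist_lt => e e0.
have e'0 : 0 < sre e.
  by rewrite -(@ltr_sreal _ s) -ger0_sreal ?ltW// sreal0.
have C0 : 0 < `|C| + 1 by rewrite ltr_wpDl.
near=> y; rewrite (ger0_sreal (ltW e0)) normr_hnorm ltr_sreal -linear_mapB//.
apply: le_lt_trans (AC _) _.
apply: le_lt_trans (_ : (`|C| + 1) * hnorm (x - y) < _).
  by rewrite ler_wpM2r ?hnorm_ge0// (le_trans (ler_norm _))// lerDl.
rewrite mulrC -ltr_pdivlMr// -(@ltr_sreal _ s) -normr_hnorm.
near: y; apply: cvgr_dist_lt; first exact: cvg_id.
by rewrite -(@sreal0 _ s) ltr_sreal divr_gt0.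
Unshelve. all: end_near. Qed.

Lemma frame_bounds (W : set H) (F : nat -> H) : lin_subspace W -> frame W F ->
  exists a b : R, [/\ 0 < a, a <= b, synthesis_bounded b F &
    forall f, W f -> a * hnorm f ^+ 2 <= sre (inner H (frame_op F f) f)].
Proof.
move=> subW [bessF [a a0 aF]].
have [b b0 bF] := bessel_synthesis_bounded subW bessF.
(* Enlarging the upper bound secures [a <= b] even when [W] is zero, where the frame inequalities do
   not relate the two constants. *)
exists a, (a + b); split=> //; first by rewrite lerDl ltW.
  move=> c m n; apply: le_trans (bF _ _ _) _.
  rewrite ler_wpM2r// ?lerDr ?(ltW a0)//.
  by apply: sumr_ge0 => k _; rewrite sqr_ge0.
move=> f Wf; rewrite -lee_fin; apply: le_trans (aF _ Wf) _.
exact: (coef_energy_le_frame_op _ b0 bF).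
Qed.

(** * Invertibility of the frame operator on [W] *)

Variables (W : set H) (F : nat -> H) (a b : R).
Hypotheses (cW : closed_subspace W) (WF : forall k, W (F k)).
Hypotheses (a0 : 0 < a) (ab : a <= b) (bF : synthesis_bounded b F).
Hypothesis aF :
  forall f, W f -> a * hnorm f ^+ 2 <= sre (inner H (frame_op F f) f).

Let b0 : 0 < b := lt_le_trans a0 ab.
Let subW := closed_subspace_lin cW.
Let S := frame_op F.

Lemma frame_op_linear : linear S.
Proof. exact: (cross_op_linear bF b0 bF). Qed.

Lemma frame_op_mem f : W (S f).
Proof. exact: (cross_op_subspace bF b0 bF f cW WF). Qed.

Lemma frame_op_self_adjoint : self_adjoint S.
Proof. by move=> f g; exact: (cross_op_adjoint f g b0 bF b0 bF). Qed.

(** The operator inequality [S^2 <= b S], on which the contraction estimate for [S] rests. *)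
Lemma frame_op_le f : hnorm (S f) ^+ 2 <= b * sre (inner H (S f) f).
Proof.
apply: (synthesis_le b0 bF).
exact: (proj1 (coef_energy_leP _ _ _) (coef_energy_le_frame_op _ b0 bF)).
Qed.

(** The map [S / b] is near the identity on [W]: by [S^2 <= b S] and the lower bound, [|x - S x /
    b|^2 <= |x|^2 - <S x, x> / b <= (1 - a / b) |x|^2]. *)
Lemma frame_op_surj y : W y -> exists2 x, W x & S x = y.
Proof.
pose t := sreal s b^-1; pose q := Num.sqrt (1 - a / b).
have ab1 : 0 <= 1 - a / b by rewrite subr_ge0 ler_pdivrMr// mul1r.
have Dq x : W x -> hnorm (x - t *: S x) <= q * hnorm x.
  move=> Wx; rewrite -(@ler_pXn2r _ 2)// ?nnegrE ?mulr_ge0 ?sqrtr_ge0 ?hnorm_ge0//.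
  rewrite exprMn sqr_sqrtr// hnorm_sqrB hnormZ sabs_sreal ?invr_ge0 ?(ltW b0)//.
  rewrite sre_innerC sre_innerZl exprMn.
  have h1 : b^-1 ^+ 2 * hnorm (S x) ^+ 2 <= b^-1 * sre (inner H (S x) x).
    apply: le_trans (_ : b^-1 ^+ 2 * (b * sre (inner H (S x) x)) <= _).
      by rewrite ler_wpM2l ?sqr_ge0// frame_op_le.
    by rewrite expr2 -!mulrA mulKf ?gt_eqF.
  have h2 : b^-1 * (a * hnorm x ^+ 2) <= b^-1 * sre (inner H (S x) x).
    by rewrite ler_pM2l ?invr_gt0// aF.
  have -> : (1 - a / b) * hnorm x ^+ 2 = hnorm x ^+ 2 - b^-1 * (a * hnorm x ^+ 2).
    by rewrite mulrBl mul1r mulrAC mulrC.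
  lra.
move=> Wy; have [||x y'|x Wx|x Wx <-] := surj_near_identity cW _ _ _ _ Dq Wy.
- exact: sqrtr_ge0.
- by rewrite -[ltRHS]sqrtr1 ltr_sqrt// gtrBl divr_gt0.
- by rewrite -scalerDr -[x]scale1r frame_op_linear !scale1r.
- by apply: subspaceZ => //; exact: frame_op_mem.
exists (t *: x); first exact: subspaceZ.
by rewrite (linear_mapZ frame_op_linear).
Qed.

Lemma frame_op_orth f : orth W f -> S f = 0.
Proof.
move=> Wf; apply: inner_ext => y; rewrite frame_op_self_adjoint inner0l.
exact/Wf/frame_op_mem.
Qed.

(** [W] is the range of [S], and the kernel of a self-adjoint operator is orthogonal to its
    range. *)
Lemma orth_frame_op f : S f = 0 -> orth W f.
Proof.
by move=> Sf w /frame_op_surj[u _ <-]; rewrite -frame_op_self_adjoint Sf inner0l.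
Qed.

Lemma frame_direct_sum : direct_sum W (orth W).
Proof.
split=> [f|].
  have [w Ww Sw] := frame_op_surj (frame_op_mem f).
  exists w, (f - w); split=> //; last by rewrite addrC subrK.
  by apply: orth_frame_op; rewrite (linear_mapB frame_op_linear) Sw subrr.
apply/seteqP; split=> [w [Ww ow]|_ ->] /=.
  by apply: inner_eq0; exact: ow.
by split; [exact: subW.1|exact: (subspace_orth W).1].
Qed.

Let P := oblique_proj W (orth W).

Lemma orthK f : orth (orth W) f -> W f.
Proof.
move=> oof; have [WP oP] := oblique_projP frame_direct_sum f.
suff -> : f = P f by [].
apply/eqP; rewrite -subr_eq0; apply/eqP/inner_eq0.
by rewrite innerBl oof// (inner_eq0C (oP _ WP)) subr0.
Qed.

Lemma frame_op_inj f g : W f -> W g -> S f = S g -> f = g.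
Proof.
move=> Wf Wg Sfg.
have Wfg : W (f - g) by exact: subspaceB.
have := aF Wfg; rewrite -/S (linear_mapB frame_op_linear) Sfg subrr.
rewrite inner0l sre0 pmulr_rle0// => /hnorm_sqr_le0/eqP.
by rewrite subr_eq0 => /eqP.
Qed.

(** [a |g|^2 <= Re <S g, g> = Re <f, g> <= |f| |g|]. This bounds the pseudo-inverse by [1 / a]. *)
Lemma frame_op_preimage_le f g : W g -> orth W (f - S g) ->
  hnorm g <= a^-1 * hnorm f.
Proof.
move=> Wg ofg; have [g0|g0] := leP (hnorm g) 0.
  by apply: le_trans g0 _; rewrite mulr_ge0 ?hnorm_ge0// invr_ge0 ltW.
rewrite mulrC ler_pdivlMr// mulrC -(ler_pM2r g0) -mulrA -expr2.
apply: le_trans (aF Wg) _; apply: le_trans (sre_inner_le _ _).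
by rewrite -/S -subr_ge0 -sreB -innerBl ofg// sre0.
Qed.

(** Let [X] send [f] to the preimage in [W] of [P f] under [S]. Then [S X = X S = P], and the
    Penrose equations follow because [P] is self-adjoint and fixes [W]. *)
Lemma frame_op_pseudo_inverse : exists X, is_pseudo_inverse S X.
Proof.
have Xex f : exists w, W w /\ S w = P f.
  have [WP _] := oblique_projP frame_direct_sum f.
  by have [w Ww Sw] := frame_op_surj WP; exists w.
have [X XP] := choice Xex; exists X.
have WX f : W (X f) := (XP f).1.
have SX f : S (X f) = P f := (XP f).2.
have subO := @subspace_orth _ _ _ W.
have Plin : linear P := oblique_proj_linear subW subO frame_direct_sum.
have Po f : orth W (f - P f) by case: (oblique_projP frame_direct_sum f).
have WP f : W (P f) by case: (oblique_projP frame_direct_sum f).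
have PW f : W f -> P f = f.
  move=> Wf; apply: (oblique_proj_eq subW subO frame_direct_sum) => //.
  by rewrite subrr; exact: subO.1.
have XS f : X (S f) = P f.
  apply: frame_op_inj => //; rewrite SX PW; last exact: frame_op_mem.
  apply/eqP; rewrite -subr_eq0 -(linear_mapB frame_op_linear).
  by rewrite frame_op_orth.
have Xlin : linear X.
  move=> c f g; apply: frame_op_inj => //; first exact: subW.2.
  by rewrite frame_op_linear !SX Plin.
have Psa : self_adjoint P.
  by move=> f g; exact: inner_oblique_proj frame_direct_sum frame_direct_sum.
split=> //.
- apply: (bounded_linear_continuous (C := a^-1) Xlin) => f.
  by apply: frame_op_preimage_le => //; rewrite SX.
- split; apply/funext => f /=.
    by rewrite SX PW//; exact: frame_op_mem.
  by rewrite XS PW.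
- by move=> f g /=; rewrite !SX.
- by move=> f g /=; rewrite !XS.
Qed.

(** * Consequences of the Penrose equations *)

Let X := pseudo_inverse S.

Lemma pseudo_inverse_frame_opP : is_pseudo_inverse S X.
Proof. exact: (getPex frame_op_pseudo_inverse). Qed.

(** [X S] is self-adjoint and kills [orth W], so the range of [X = X S X] is orthogonal to
    [orth W]. *)
Lemma pseudo_inverse_mem f : W (X f).
Proof.
have [Xlin _ [_ XSX] _ XSsa] := pseudo_inverse_frame_opP.
apply: orthK => u ou; rewrite -XSX.
have -> : (X \o S \o X) f = (X \o S) (X f) by [].
rewrite XSsa /= (frame_op_orth ou) (linear_map0 Xlin).
exact: inner0r.
Qed.

Lemma pseudo_inverse_orth f : orth W (f - S (X f)).
Proof.
have [_ _ [SXS _] SXsa _] := pseudo_inverse_frame_opP.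
move=> w /frame_op_surj[u _ <-].
rewrite innerBl; apply/eqP; rewrite subr_eq0; apply/eqP/esym.
by rewrite -[in RHS]SXS; exact: SXsa.
Qed.

Lemma pseudo_inverse_frame_op f : orth W (f - X (S f)).
Proof.
have [_ _ [SXS _] _ _] := pseudo_inverse_frame_opP.
apply: orth_frame_op; rewrite (linear_mapB frame_op_linear).
by rewrite -[X in X - _ = _](congr1 (fun A => A f) SXS) subrr.
Qed.

(** Values of [X] lie in [W], so against them [f] and [g] may be replaced by [S (X f)] and
    [S (X g)]; self-adjointness of [S] does the rest. *)
Lemma pseudo_inverse_self_adjoint : self_adjoint X.
Proof.
move=> f g; transitivity (inner H (S (X f)) (X g)).
  rewrite frame_op_self_adjoint; apply/eqP; rewrite -subr_eq0 -innerBr.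
  by rewrite (inner_eq0C (pseudo_inverse_orth _ (pseudo_inverse_mem _))).
apply/esym/eqP; rewrite -subr_eq0 -innerBl.
by rewrite (pseudo_inverse_orth _ (pseudo_inverse_mem _)).
Qed.

Lemma pseudo_inverse_le f : hnorm (X f) <= a^-1 * hnorm f.
Proof.
apply: frame_op_preimage_le; first exact: pseudo_inverse_mem.
exact: pseudo_inverse_orth.
Qed.

End FrameOperator.

(** * Approximate oblique duals *)

Section ObliqueDuals.
Variables (R : realType) (s : scalar_kind) (H : hilbertSpace R s).
Local Notation K := (scalars R s).
Implicit Types (x y z f g : H).

Lemma opnorm_le (A : H -> H) (C : R) : linear A ->
  (opnorm A <= C%:E)%E -> forall x, hnorm (A x) <= C * hnorm x.
Proof.
move=> lA AC x; have [x0|x0] := leP (hnorm x) 0.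
  by rewrite (hnorm_le0 x0) (linear_map0 lA) hnorm0 mulr0.
set t := sreal s (hnorm x)^-1.
have tE : sabs t = (hnorm x)^-1 by rewrite sabs_sreal// invr_ge0 ltW.
have : ((hnorm (A (t *: x)))%:E <= C%:E)%E.
  apply: le_trans AC; apply: ereal_sup_ubound; exists (t *: x) => //=.
  by rewrite hnormZ tE mulVf// gt_eqF.
by rewrite lee_fin (linear_mapZ lA) hnormZ tE ler_pdivrMl// mulrC.
Qed.

(** Passes a norm bound to an adjoint: when [z = T^* x] and [T] is bounded by [C], the premise is
    Cauchy-Schwarz for [|z|^2 = <x, T z>]. *)
Lemma hnorm_le_adjoint (C : R) x z : 0 <= C ->
  hnorm z ^+ 2 <= hnorm x * (C * hnorm z) -> hnorm z <= C * hnorm x.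
Proof.
move=> C0 le_z; have [z0|z0] := leP (hnorm z) 0.
  by apply: le_trans z0 _; rewrite mulr_ge0 ?hnorm_ge0.
by rewrite -(ler_pM2r z0) -expr2 mulrAC mulrC.
Qed.

Section ApproximateDual.
Variables (W V : set H) (F G : nat -> H) (eps a b b' : R).
Hypotheses (cW : closed_subspace W) (cV : closed_subspace V).
Hypothesis WV : direct_sum W (orth V).
Hypotheses (WF : forall k, W (F k)) (VG : forall k, V (G k)).
Hypotheses (a0 : 0 < a) (ab : a <= b) (bF : synthesis_bounded b F).
Hypothesis aF :
  forall f, W f -> a * hnorm f ^+ 2 <= sre (inner H (frame_op F f) f).
Hypotheses (b'0 : 0 < b') (bG : synthesis_bounded b' G).
Hypotheses (eps0 : 0 <= eps) (eps1 : eps < 1).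

Let b0 : 0 < b := lt_le_trans a0 ab.
Let subW := closed_subspace_lin cW.
Let subV := closed_subspace_lin cV.
Let piW := oblique_proj W (orth V).
Let piV := oblique_proj V (orth W).
Let A := cross_op G F.
Let B := cross_op F G.
Let X := pseudo_inverse (frame_op F).

Hypothesis dual : (opnorm (fun f => (piW f - synthesis_op F (analysis_op G f))%R)
                   <= eps%:E)%E.

Lemma cross_op_adjointAB x y : inner H (A x) y = inner H x (B y).
Proof. exact: (cross_op_adjoint x y b'0 bG b0 bF). Qed.

Lemma approx_dual_le x : hnorm (piW x - B x) <= eps * hnorm x.
Proof.
apply: (@opnorm_le (fun f => piW f - B f)) dual _ => c u v.
rewrite [piW _](oblique_proj_linear subW (@subspace_orth _ _ _ V) WV).
by rewrite [B _](cross_op_linear bF b'0 bG) opprD addrACA scalerBr.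
Qed.

(* Compressed to [W], [A] is the adjoint of [B], hence within [eps < 1] of the
   identity; so each [y] agrees with some [A u] modulo [orth W]. *)
Lemma approx_dual_direct_sum : direct_sum V (orth W).
Proof.
have dsW := frame_direct_sum cW WF a0 ab bF aF.
have subO := @subspace_orth _ _ _ W.
set P := oblique_proj W (orth W).
have Po f : orth W (f - P f) by case: (oblique_projP dsW f).
have WP f : W (P f) by case: (oblique_projP dsW f).
have Plin : linear P := oblique_proj_linear subW subO dsW.
have Alin : linear A := cross_op_linear bG b0 bF.
split=> [y|]; last first.
  apply/seteqP; split=> [v [Vv ov]|_ ->] /=; last first.
    by split; [exact: subV.1|exact: subO.1].
  (* Both components of [v = w + u] are orthogonal to [v]: [w] because [v] is in [orth W], [u]
     because [v] is in [V]. *)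
  have [w [u [Ww ou vE]]] := WV.1 v.
  apply: inner_eq0; rewrite {2}vE innerDr ov// (inner_eq0C (ou _ Vv)).
  exact: addr0.
have [||u v|w Ww|w Ww|u Wu Du] :=
  @surj_near_identity _ _ _ W (P \o A) eps cW _ _ _ _ _ _ (WP y) => //=.
- by rewrite -[u]scale1r Alin Plin !scale1r.
- set z := w - _; have Wz : W z by apply: subspaceB => //; exact: WP.
  apply: hnorm_le_adjoint => //.
  have -> : hnorm z ^+ 2 = sre (inner H w (piW z - B z)).
    have -> : piW z = z.
      apply: (oblique_proj_eq subW (@subspace_orth _ _ _ V) WV) => //.
      by rewrite subrr; exact: (subspace_orth V).1.
    rewrite hnorm_sqr {1}/z innerBl innerBr -cross_op_adjointAB.
    congr (sre (_ - _)); apply/esym/eqP.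
    by rewrite -subr_eq0 -innerBl Po.
  apply: le_trans (sre_inner_le _ _) _.
  by rewrite ler_wpM2l ?hnorm_ge0// approx_dual_le.
exists (A u), (y - A u); split.
- exact: (cross_op_subspace bG b0 bF u cV VG).
- rewrite (_ : y - A u = (y - P y) - (A u - P (A u))); last first.
    by rewrite -[P (A u)]/((P \o A) u) Du opprB addrA subrK.
  exact: (subspaceB subO (Po y) (Po (A u))).
- by rewrite addrC subrK.
Qed.

(** * The duality defect [E] and the perturbation [r] *)

Let VW := approx_dual_direct_sum.
Let E x := A x - piV x.

(** [A] and [piV] are the adjoints of [B] and [piW]; the sign reflects the opposite order of
    subtraction. *)
Lemma approx_dual_adjoint x y : inner H (E x) y = - inner H x (piW y - B y).
Proof.
rewrite innerBl innerBr opprB cross_op_adjointAB.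
by rewrite (inner_oblique_proj _ _ WV VW).
Qed.

Lemma approx_dual_adjoint_le x : hnorm (E x) <= eps * hnorm x.
Proof.
apply: hnorm_le_adjoint => //.
rewrite hnorm_sqr approx_dual_adjoint -innerNr.
apply: le_trans (sre_inner_le _ _) _.
by rewrite hnorm_opp ler_wpM2l ?hnorm_ge0// approx_dual_le.
Qed.

Lemma approx_dual_linear : linear E.
Proof.
move=> c u v; rewrite /E.
rewrite [piV _](oblique_proj_linear subV (@subspace_orth _ _ _ W) VW).
by rewrite [A _](cross_op_linear bG b0 bF) opprD addrACA scalerBr.
Qed.

(** The adjoint of [E] takes its values in [W]. *)
Lemma approx_dual_orth x : orth W x -> E x = 0.
Proof.
move=> ox; apply: inner_ext => y; rewrite approx_dual_adjoint inner0l ox ?oppr0//.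
apply: (subspaceB subW); last exact: (cross_op_subspace bF b'0 bG y cW WF).
by have [] := oblique_projP WV y.
Qed.

Let r k := E (X (F k)).

(** Expresses the coefficients against [r] as coefficients against [F] of another vector, so that
    facts about [F] transfer to [r]. *)
Lemma inner_approx_dual k x :
  inner H x (r k) = inner H (- X (piW x - B x)) (F k).
Proof.
rewrite -inner_conj approx_dual_adjoint -innerNr inner_conj !innerNl.
by rewrite (pseudo_inverse_self_adjoint cW WF a0 ab bF aF).
Qed.

Lemma approx_dual_bessel : bessel_seq V r.
Proof.
split=> [k|].
  apply: subspaceB => //; first exact: (cross_op_subspace bG b0 bF _ cV VG).
  by have [] := oblique_projP VW (X (F k)).
(* [b] comes from the coefficient energy of [F], [a^-1] from the pseudo-inverse, [eps] from the
   duality defect. *)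
exists (b * (a^-1 * eps) ^+ 2) => f _.
rewrite /coef_energy /analysis_op.
under eq_eseriesr do rewrite inner_approx_dual.
apply: le_trans (coef_energy_le b0 bF _) _.
have XE_le : hnorm (- X (piW f - B f)) <= a^-1 * eps * hnorm f.
  rewrite hnorm_opp -mulrA.
  apply: le_trans (pseudo_inverse_le cW WF a0 ab bF aF _) _.
  by rewrite ler_pM2l ?invr_gt0// approx_dual_le.
rewrite lee_fin -mulrA -exprMn ler_pM2l// ler_pXn2r// nnegrE ?hnorm_ge0//.
exact: le_trans (hnorm_ge0 _) XE_le.
Qed.

(** Tested against [y], the series becomes [<f, S (- X (piW y - B y))>]. Moving [S], [X] and the
    defect to the left gives [E (X (S f))], and [E] kills [f - X (S f)]. *)
Lemma approx_dual_synthesis f :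
  limn (series (fun k => inner H f (F k) *: r k)) = E f.
Proof.
have [c c0 cr] := bessel_synthesis_bounded subV approx_dual_bessel.
rewrite -[LHS]/(cross_op r F f); apply: inner_ext => y.
rewrite (cross_op_adjoint f y c0 cr b0 bF).
have -> : cross_op F r y = frame_op F (- X (piW y - B y)).
  rewrite /cross_op/= /frame_op/=; congr (synthesis_op F _).
  by apply/funext => k; rewrite /analysis_op inner_approx_dual.
rewrite -(frame_op_self_adjoint a0 ab bF) innerNr.
rewrite -(pseudo_inverse_self_adjoint cW WF a0 ab bF aF) -approx_dual_adjoint.
congr (inner H _ y); apply/eqP; rewrite eq_sym -subr_eq0.
rewrite -(linear_mapB approx_dual_linear) approx_dual_orth//.
exact: (pseudo_inverse_frame_op cW WF a0 ab bF aF).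
Qed.

End ApproximateDual.
End ObliqueDuals.

Theorem theorem4p6 (R : realType) (s : scalar_kind) (H : hilbertSpace R s)
    (W V : set H) (F : nat -> H) (eps : R) :
  separable H ->
  closed_subspace W -> closed_subspace V ->
  direct_sum W (orth V) ->
  frame W F ->
  0 <= eps -> eps < 1 ->
  forall G : nat -> H, approx_oblique_dual eps W V F G ->
  exists h r : nat -> H,
    [/\ bessel_seq V h, bessel_seq V r,
        forall f : H,
          hnorm (limn (series (fun k => inner H f (F k) *: r k)))
          <= eps * hnorm f &
        forall k : nat,
          G k = oblique_proj V (orth W) (pseudo_inverse (frame_op F) (F k))
                + h k
                - limn (series (fun j =>
                    inner H (pseudo_inverse (frame_op F) (F k)) (F j) *: h j))
                + r k].
Proof.
move=> _ cW cV WV frF eps0 eps1 G [_ frG dual].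
have [a [b [a0 ab bF aF]]] := frame_bounds (closed_subspace_lin cW) frF.
have [[WF _] _] := frF; have [bessG _] := frG; have [VG _] := bessG.
have [b' b'0 bG] := bessel_synthesis_bounded (closed_subspace_lin cV) bessG.
set X := pseudo_inverse (frame_op F).
exists G, (fun k => cross_op G F (X (F k)) - oblique_proj V (orth W) (X (F k))).
split=> // [|f|k].
- exact: (approx_dual_bessel cW cV WV WF VG a0 ab bF aF b'0 bG eps0 eps1 dual).
- rewrite (approx_dual_synthesis cW cV WV WF VG a0 ab bF aF b'0 bG eps0 eps1
             dual).
  exact: (approx_dual_adjoint_le cW cV WV WF VG a0 ab bF aF b'0 bG eps0 eps1
            dual).
(* With [h = G], the term [r k] adds this series back and removes the projected term, leaving
   [G k]. *)
- rewrite -[limn _]/(cross_op G F (X (F k))).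
  by rewrite addrA subrK addrC addKr.
Qed.
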